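(* Let $A = (a_{ij})_{i,j=1}^n$ be a real $n \times n$ matrix which is a $P$-matrix and such that $(DA)^2$ is a $Q$-matrix for every positive diagonal matrix $D$. Then $$\det A \leq \frac{1}{\sin^n \frac{\pi}{2n}}\prod_{i=1}^n a_{ii}.$$
   Context: A real $n\times n$ matrix is called a $P$-matrix if all its principal minors are positive, and a $Q$-matrix if for every $k = 1,\ldots,n$ the sum of all its principal minors of order $k$ is positive. A positive diagonal matrix is a diagonal matrix with all diagonal entries $>0$. *)

(* Defs.v *)
From HB Require Import structures.
From mathcomp Require Import all_boot all_order all_algebra.

Set Implicit Arguments.
Unset Strict Implicit.
Unset Printing Implicit Defensive.

Import Order.TTheory GRing.Theory Num.Theory.

Local Open Scope ring_scope.

(* [enum_val] lists the elements of [S] without repetition; the order of the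
   list is irrelevant here, since rows and columns are permuted alike. *)
Definition principal_minor (R : comNzRingType) (n : nat) (A : 'M[R]_n)
    (S : {set 'I_n}) : R :=
  \det (mxsub (@enum_val _ (mem S)) (@enum_val _ (mem S)) A).

Definition P_matrix (R : numDomainType) (n : nat) (A : 'M[R]_n) : Prop :=
  forall S : {set 'I_n}, S != set0 -> 0 < principal_minor A S.

Definition Q_matrix (R : numDomainType) (n : nat) (A : 'M[R]_n) : Prop :=
  forall k : nat, (0 < k <= n)%N ->
    0 < \sum_(S : {set 'I_n} | #|S| == k) principal_minor A S.

Definition positive_diagonal (R : numDomainType) (n : nat) (D : 'M[R]_n) :
    Prop :=
  is_diag_mx D /\ forall i, 0 < D i i.

(* Main.v *)
(* Every eigenvalue z of DA, for D positive diagonal, satisfies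
   Re z >= sin(pi/2n) |z|.  With D = diag(1/a_ii) the trace of DA is n, and AM-GM
   applied to the real parts of the eigenvalues bounds
   det(DA) = det A / prod a_ii by 1 / sin^n(pi/2n).

   That Re z > 0 is shown by induction on n.  Since (DA)^2 is a Q-matrix,
   det(x + (DA)^2) >= x^n for x > 0, so DA has no eigenvalue on the imaginary
   axis; unlike the Q-property itself, this inequality survives letting an entry
   of D tend to 0, hence passes to principal submatrices.  Scaling the first row
   by t, the spectrum tends as t -> 0 to that of a principal submatrix together
   with one eigenvalue that goes to 0 through values of positive real part; as t
   grows from 0 to 1 no eigenvalue can cross the imaginary axis.

   Given Re z > 0, the sharper sector comes from Kellogg's argument: -z^2 is a
   root of det(x + (DA)^2), a polynomial in x of degree n with positive
   coefficients, and such a polynomial has no root w with |arg w| < pi/n. *)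
Require Import Defs.
From HB Require Import structures.
From mathcomp Require Import boolp classical_sets.
From mathcomp Require Import all_boot all_order all_fingroup all_algebra.
From mathcomp Require Import reals trigo.
From mathcomp Require Import complex polyrcf ring lra.

Set Implicit Arguments.
Unset Strict Implicit.
Unset Printing Implicit Defensive.

Import Order.TTheory GRing.Theory Num.Theory.

Local Open Scope ring_scope.
Local Open Scope complex_scope.

(** * Principal minors and characteristic polynomials *)

(** Two injective enumerations of the same indices differ by a permutation. It acts on rows and
    columns alike, so its sign enters squared. Hence [enum_val] in [principal_minor] can be traded
    for any convenient enumeration. *)
Lemma det_mxsub_codom (R : comNzRingType) (n m m' : nat) (A : 'M[R]_n)
    (f : 'I_m -> 'I_n) (g : 'I_m' -> 'I_n) :
  injective f -> injective g -> codom f =i codom g ->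
  \det (mxsub f f A) = \det (mxsub g g A).
Proof.
move=> f_inj g_inj eq_fg.
have eq_m : m = m'.
  by rewrite -[m]card_ord -(card_codom f_inj) (eq_card eq_fg) card_codom ?card_ord.
case: m' / eq_m g g_inj eq_fg => g g_inj eq_fg.
have fg i : f i \in codom g by rewrite -eq_fg codom_f.
have s_inj : injective (fun i => iinv (fg i)).
  by move=> i j eq_ij; apply: f_inj; rewrite -(f_iinv (fg i)) eq_ij f_iinv.
pose s := perm s_inj.
have -> : mxsub f f A = row_perm s (col_perm s (mxsub g g A)).
  by apply/matrixP=> i j; rewrite !mxE !permE !f_iinv.
rewrite row_permE col_permE !det_mulmx !det_perm mulrCA odd_permV -expr2.
by rewrite sqrr_sign mulr1.
Qed.

Lemma det_rows_principal (R : comNzRingType) (n : nat) (A : 'M[R]_n)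
    (S : {set 'I_n}) (x : R) :
  \det (\matrix_(i, j) (if i \in S then A i j else x *+ (i == j))) =
  principal_minor A S * x ^+ (n - #|S|).
Proof.
set B := \matrix_(_, _) _.
(* Listing [S] first and its complement second makes [B] block upper triangular, with lower right
   block [x%:M]. *)
pose h (k : 'I_(#|S| + #|~: S|)) := match split k with
  | inl i => enum_val i | inr i => enum_val i end.
have hl i : h (lshift _ i) = enum_val i.
  by rewrite /h (unsplitK (inl _ i)).
have hr i : h (rshift _ i) = enum_val i.
  by rewrite /h (unsplitK (inr _ i)).
have SP (i : 'I_#|S|) : enum_val i \in S := enum_valP i.
have CP (i : 'I_#|~: S|) : enum_val i \in ~: S := enum_valP i.
have h_inj : injective h.
  move=> i j; case: (split_ordP i) => {}i ->; case: (split_ordP j) => {}j ->.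
  - by rewrite !hl => /enum_val_inj ->.
  - by rewrite hl hr => eq_ij; have := CP j; rewrite -eq_ij inE SP.
  - by rewrite hl hr => eq_ij; have := CP i; rewrite eq_ij inE SP.
  - by rewrite !hr => /enum_val_inj ->.
have eq_h : codom (@id 'I_n) =i codom h.
  move=> i; rewrite (codom_f id); apply/esym/codomP.
  have [iS|iS] := boolP (i \in S).
    by exists (lshift _ (enum_rank_in iS i)); rewrite hl enum_rankK_in.
  have {}iS : i \in ~: S by rewrite inE.
  by exists (rshift _ (enum_rank_in iS i)); rewrite hr enum_rankK_in.
have -> : B = mxsub id id B by apply/matrixP => i j; rewrite !mxE.
rewrite (det_mxsub_codom B (@inj_id _) h_inj eq_h).
have -> : mxsub h h B = block_mx (mxsub (@enum_val _ (mem S)) (@enum_val _ (mem S)) A)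
   (mxsub (@enum_val _ (mem S)) (@enum_val _ (mem (~: S))) A) 0 x%:M.
  apply/matrixP => i j; case: (split_ordP i) => {}i ->; case: (split_ordP j) => {}j ->;
    rewrite ?block_mxEul ?block_mxEur ?block_mxEdl ?block_mxEdr !mxE ?hl ?hr ?SP //.
  - have /[!inE] /negPf-> := CP i; case: eqP => // e.
    by have /[!inE] := CP i; rewrite e SP.
  - by have /[!inE] /negPf-> := CP i; rewrite (inj_eq enum_val_inj).
rewrite det_ublock det_scalar; congr (_ * x ^+ _).
by rewrite -[X in (X - _)%N](card_ord n) -(cardsC S) addKn.
Qed.

Lemma principal_minor_map (R S : comNzRingType) (f : {rmorphism R -> S})
    (n : nat) (A : 'M[R]_n) (J : {set 'I_n}) :
  principal_minor (map_mx f A) J = f (principal_minor A J).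
Proof. by rewrite /principal_minor -det_map_mx map_mxsub. Qed.

(** Multilinear expansion of det(X + A) in its rows: [S] collects the rows taken from [A], the
    others being taken from X times the identity. Using [- A] keeps the formula free of signs. *)
Lemma char_polyN_minors (R : comNzRingType) (n : nat) (A : 'M[R]_n) :
  char_poly (- A) =
  \sum_(S : {set 'I_n}) (principal_minor A S)%:P * 'X^(n - #|S|).
Proof.
transitivity (\sum_(S : {set 'I_n}) \det (\matrix_(i, j)
    (if i \in S then (map_mx polyC A) i j else 'X *+ (i == j)))).
  rewrite [RHS]exchange_big /=; apply: eq_bigr => s _.
  rewrite -mulr_sumr; congr (_ * _).
  rewrite -[RHS]/(\sum_(J in {set 'I_n}) _).
  under [RHS]eq_bigr do under eq_bigr do rewrite mxE.
  rewrite -(bigA_distr _ _ (fun i => map_mx polyC A i (s i)) (fun i => 'X *+ (i == s i))).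
  by apply: eq_bigr => i _; rewrite !mxE polyCN opprK addrC.
by apply: eq_bigr => S _; rewrite det_rows_principal principal_minor_map.
Qed.

Lemma coef_char_polyN (R : comNzRingType) (n : nat) (A : 'M[R]_n) (k : nat) :
  (k <= n)%N -> (char_poly (- A))`_(n - k) =
  \sum_(S : {set 'I_n} | #|S| == k) principal_minor A S.
Proof.
move=> le_kn; rewrite char_polyN_minors coef_sum [RHS]big_mkcond /=.
apply: eq_bigr => S _; rewrite coefCM coefXn.
have le_Sn : (#|S| <= n)%N by rewrite -[X in (_ <= X)%N](card_ord n) max_card.
have -> : (n - k == n - #|S|)%N = (#|S| == k).
  apply/eqP/eqP => [eq_k|->//].
  by rewrite -(subKn le_Sn) -eq_k subKn.
by case: eqP; rewrite ?mulr1 ?mulr0.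
Qed.

Lemma horner_char_poly (R : comNzRingType) (n : nat) (A : 'M[R]_n) (x : R) :
  (char_poly A).[x] = \det (x%:M - A).
Proof.
rewrite -[LHS]/(horner_eval x _) -det_map_mx; congr (\det _).
apply/matrixP => i j; rewrite !mxE /= /horner_eval hornerD hornerN !hornerE.
by rewrite hornerMn hornerX.
Qed.

Lemma Q_matrix_coef_gt0 (R : realDomainType) (n : nat) (A : 'M[R]_n) (i : nat) :
  Q_matrix A -> (i <= n)%N -> 0 < (char_poly (- A))`_i.
Proof.
(* The case [i = n] would be [k = 0], outside the range of [Q_matrix]; there the coefficient is the
   leading one. *)
move=> A_Q; rewrite leq_eqVlt => /predU1P[->|lt_in].
  have /monicP := char_poly_monic (- A).
  by rewrite lead_coefE size_char_poly /= => ->.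
rewrite -(subKn (ltnW lt_in)) coef_char_polyN ?leq_subr //.
by apply: A_Q; rewrite subn_gt0 lt_in leq_subr.
Qed.

Lemma Q_matrix_det (R : realDomainType) (n : nat) (A : 'M[R]_n) (x : R) :
  Q_matrix A -> 0 <= x -> x ^+ n <= \det (x%:M + A).
Proof.
move=> A_Q x_ge0.
rewrite -{1}[A]opprK -horner_char_poly.
rewrite horner_coef size_char_poly big_ord_recr /=.
have /monicP := char_poly_monic (- A); rewrite lead_coefE size_char_poly /= => ->.
rewrite mul1r lerDr; apply: sumr_ge0 => i _; rewrite mulr_ge0 ?exprn_ge0 //.
by rewrite ltW // Q_matrix_coef_gt0 // ltnW.
Qed.

Lemma det_sqr_root (R : comNzRingType) (n : nat) (A : 'M[R]_n) (z : R) :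
  root (char_poly A) z -> \det ((- z ^+ 2)%:M + A *m A) = 0.
Proof.
move=> /rootP; rewrite horner_char_poly => detA.
suff -> : (- z ^+ 2)%:M + A *m A = - (z%:M - A) *m (z%:M + A).
  by rewrite mulNmx -scaleN1r detZ det_mulmx detA mul0r mulr0.
rewrite mulNmx mulmxBl !mulmxDr -scalar_mxM scalar_mxC opprB.
by rewrite [(z * z)%:M + _]addrC opprD addrACA subrr add0r addrC expr2 raddfN.
Qed.

(** * Polynomials with roots in the right half-plane *)

Definition right_stable (C : numClosedFieldType) (p : {poly C}) : Prop :=
  forall z, root p z -> 0 < 'Re z.

Lemma right_stable_prod (C : numClosedFieldType) (p : {poly C}) :
  p \is monic -> right_stable p ->
  exists2 s : seq C, p = \prod_(z <- s) ('X - z%:P) &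
    size s = (size p).-1 /\ {in s, forall z, 0 < 'Re z}.
Proof.
move=> /monicP p_monic p_stable.
have [s def_p] := closed_field_poly_normal p.
rewrite p_monic scale1r in def_p.
exists s => //; split=> [|z sz]; first by rewrite def_p size_prod_XsubC.
by apply: p_stable; rewrite def_p root_prod_XsubC.
Qed.

Lemma horner_prod_XsubC (R : comNzRingType) (s : seq R) (z : R) :
  (\prod_(w <- s) ('X - w%:P)).[z] = \prod_(w <- s) (z - w).
Proof. by rewrite horner_prod; apply: eq_bigr => w _; rewrite hornerXsubC. Qed.

Lemma norm_horner_le (R : numDomainType) (n : nat) (p : {poly R}) (z : R) :
  (size p <= n.+1)%N ->
  `|p.[z]| <= (\sum_(i < size p) `|p`_i|) * (1 + `|z|) ^+ n.
Proof.
move=> size_p; rewrite horner_coef mulr_suml.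
apply: le_trans (ler_norm_sum _ _ _) _; apply: ler_sum => i _.
rewrite normrM normrX ler_wpM2l //.
apply: (@le_trans _ _ ((1 + `|z|) ^+ i)).
  by rewrite lerXn2r ?nnegrE ?addr_ge0 ?ler_wpDl.
rewrite ler_weXn2l ?lerDl //.
by rewrite -ltnS (leq_trans (ltn_ord i)).
Qed.

Lemma Re_sub_le_norm (C : numClosedFieldType) (z w : C) :
  'Re w - 'Re z <= `|z - w|.
Proof. by rewrite distrC -raddfB; apply: leif_Re_Creal. Qed.

(** On the closed left half-plane each factor |z - w| of [p] is at least a constant times 1 + |z|,
    so |p(z)| is bounded below by a multiple of (1 + |z|)^deg p, a power that also bounds |r(z)|
    from above. No compactness is involved. *)
Lemma right_stable_dominates (C : numClosedFieldType) (p r : {poly C}) :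
  p \is monic -> right_stable p -> (size r <= size p)%N ->
  exists2 k : C, 0 < k & forall z, 'Re z <= 0 -> k * `|r.[z]| <= `|p.[z]|.
Proof.
move=> p_monic p_stable size_r.
have [s def_p [size_s s_gt0]] := right_stable_prod p_monic p_stable.
have [k k_gt0 kP] : exists2 k : C, 0 < k & forall z, 'Re z <= 0 ->
    k * (1 + `|z|) ^+ size s <= \prod_(w <- s) `|z - w|.
  elim: s s_gt0 {def_p size_s} => [|w s IHs] s_gt0.
    by exists 1 => // z _; rewrite big_nil mulr1.
  have [k k_gt0 kP] := IHs (fun z sz => s_gt0 z (mem_behead (s := w :: s) sz)).
  have w_gt0 : 0 < 'Re w by apply: s_gt0; rewrite mem_head.
  have w1_gt0 : 0 < 1 + `|w| by rewrite ltr_wpDr.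
  have d_gt0 : 0 < (1 + `|w|) / 'Re w + 1 by rewrite ltr_wpDl // ltW ?divr_gt0.
  (* The constant comes from 1 + |z| <= (1 + |w|) + |z - w| together with Re w <= |z - w|. *)
  exists (((1 + `|w|) / 'Re w + 1)^-1 * k); first by rewrite mulr_gt0 ?invr_gt0.
  move=> z z_le0; rewrite big_cons exprS mulrACA ler_pM ?kP //.
  - by rewrite mulr_ge0 ?invr_ge0 ?addr_ge0 // ltW ?divr_gt0.
  - by rewrite mulr_ge0 ?exprn_ge0 ?addr_ge0 // ltW.
  have Re_le : 'Re w <= `|z - w|.
    by apply: le_trans (Re_sub_le_norm z w); rewrite lerDl oppr_ge0.
  rewrite mulrC ler_pdivrMr // mulrDr mulr1.
  apply: (@le_trans _ _ (1 + `|w| + `|z - w|)).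
    by rewrite -addrA lerD2l addrC -{1}(subrK w z) ler_normD.
  rewrite lerD2r mulrCA ler_peMr //; first exact: ltW.
  by rewrite ler_pdivlMr ?mul1r.
pose c := \sum_(i < size r) `|r`_i|.
have c_ge0 : 0 <= c by apply: sumr_ge0.
have c1_gt0 : 0 < c + 1 by rewrite ltr_wpDl.
exists (k / (c + 1)) => [|z z_le0]; first by rewrite divr_gt0.
rewrite def_p horner_prod_XsubC normr_prod; apply: le_trans (kP z z_le0).
rewrite -mulrA ler_pM2l // mulrC ler_pdivrMr // mulrC.
have size_r' : (size r <= (size s).+1)%N.
  by rewrite size_s prednK // size_poly_gt0 monic_neq0.
apply: le_trans (norm_horner_le z size_r') _.
by rewrite ler_wpM2r ?exprn_ge0 ?addr_ge0 // lerDl.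
Qed.

(** Each root w has |z - w| >= Re w - Re z >= - Re z. The bound depends on [p] only through its
    degree, hence is uniform over a family of stable polynomials of fixed degree. *)
Lemma right_stable_horner_lt0 (C : numClosedFieldType) (p : {poly C}) (z : C) :
  p \is monic -> right_stable p -> 'Re z < 0 ->
  (- 'Re z) ^+ (size p).-1 <= `|p.[z]|.
Proof.
move=> p_monic p_stable z_lt0.
have [s -> [<- s_gt0]] := right_stable_prod p_monic p_stable.
rewrite horner_prod_XsubC normr_prod.
elim: s s_gt0 => [|w s IHs] s_gt0; first by rewrite big_nil.
rewrite big_cons exprS ler_pM ?exprn_ge0 ?oppr_ge0 ?(ltW z_lt0) //.
  apply: le_trans (Re_sub_le_norm z w).
  by rewrite lerDr ltW // s_gt0 ?mem_head.
by apply: IHs => v sv; rewrite s_gt0 // inE sv orbT.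
Qed.

(** A supremum argument replaces continuity of the roots: the set of stable parameters is shown to
    contain its supremum [s], and to extend beyond it unless [s = b]. The strict bound on the size
    of [r] keeps every member of the family monic of the same degree. *)
Lemma right_stable_homotopy (R : realType) (p r : {poly R[i]}) (a b : R) :
  a <= b -> p \is monic -> (size r < size p)%N ->
  (forall t, a <= t <= b -> forall z, root (p + t%:C *: r) z -> 'Re z != 0) ->
  right_stable (p + a%:C *: r) -> right_stable (p + b%:C *: r).
Proof.
move=> le_ab p_monic size_r Re_neq0 a_stable.
pose F (t : R) := p + t%:C *: r.
have size_tr t : (size (t%:C *: r) < size p)%N.
  exact: leq_ltn_trans (size_scale_leq _ _) size_r.
have sizeF t : size (F t) = size p by rewrite size_polyDl.
have F_monic t : F t \is monic.
  by rewrite monicE lead_coefDl // -monicE.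
have FE s t z : (F s).[z] = (F t).[z] + (s - t)%:C * r.[z].
  by rewrite !hornerE rmorphB /=; ring.
pose E : set R := fun t => a <= t <= b /\ right_stable (F t).
have E_sup : has_sup E.
  by split; [exists a; rewrite /E lexx | exists b => t [/andP[]]].
set s := sup E.
have le_as : a <= s by apply: sup_upper_bound => //; rewrite /E lexx.
have le_sb : s <= b by apply: sup_le_ub; [case: E_sup | move=> t [/andP[]]].
have [s_stable|] := pselect (right_stable (F s)).
  have [<-//|lt_sb] := eqVneq s b.
  have {}lt_sb : s < b by rewrite lt_neqAle lt_sb.
  have size_rF : (size r <= size (F s))%N by rewrite sizeF ltnW.
  have [k k_gt0 kP] := right_stable_dominates (F_monic s) s_stable size_rF.
  have k_real : (complex.Re k)%:C = k by rewrite complexRe; apply/Creal_ReP/gtr0_real.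
  move: (complex.Re k) k_real k_gt0 kP => {}k <-; rewrite ltcR => k_gt0 kP.
  (* A root z of [F (s + d)] with Re z <= 0 would give k |r(z)| <= |F_s(z)| = d |r(z)|, impossible
     for [d < k] unless r(z) = 0, in which case z is already a root of [F s]. *)
  pose d := Num.min (k / 2) (b - s).
  have d_gt0 : 0 < d by rewrite lt_min divr_gt0 // subr_gt0.
  have lt_dk : d < k by rewrite gt_min ltr_pdivrMr // ltr_pMr // ltr1n.
  have sdb : a <= s + d <= b.
    rewrite (le_trans le_as) ?lerDl ?(ltW d_gt0) //=.
    by rewrite -lerBrDl ge_min lexx orbT.
  suff sd_E : E (s + d).
    by have := sup_upper_bound E_sup sd_E; rewrite gerDl leNgt d_gt0.
  split=> // z z_root; have Rez := Re_neq0 _ sdb z z_root.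
  have Re_real := Creal_Re z; rewrite real_ltNge // ?real0 //.
  apply/negP => z_le0.
  have := kP z z_le0; rewrite (FE s (s + d)) (rootP z_root) add0r opprD addNKr.
  have [r0 _|r_neq0] := eqVneq r.[z] 0.
    have /s_stable : root (F s) z.
      by rewrite /root (FE s (s + d)) (rootP z_root) r0 mulr0 addr0.
    by move/lt_geF; rewrite z_le0.
  rewrite normrM ler_pM2r ?normr_gt0 // rmorphN normrN.
  by rewrite ger0_norm ?ler0c ?(ltW d_gt0) // lecR leNgt lt_dk.
move=> s_unstable; exfalso; apply: s_unstable => z z_root.
have Rez : 'Re z != 0 by apply: Re_neq0 z_root; rewrite le_as.
have Re_real := Creal_Re z.
rewrite real_ltNge ?real0 //; apply/negP; rewrite le_eqVlt (negPf Rez) /= => z_lt0.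
(* For stable [F t] one has c <= |F_t(z)| = (s - t) |r(z)|, which fails once [t] is close enough to
   [s]. *)
pose c := (- 'Re z) ^+ (size p).-1.
have c_gt0 : 0 < c by rewrite exprn_gt0 // oppr_gt0.
have r1_gt0 : 0 < `|r.[z]| + 1 by rewrite ltr_wpDl.
have e_gt0 := divr_gt0 c_gt0 r1_gt0.
have e_real : (complex.Re (c / (`|r.[z]| + 1)))%:C = c / (`|r.[z]| + 1).
  by rewrite complexRe; apply/Creal_ReP/gtr0_real.
rewrite -e_real ltcR in e_gt0.
have [t tE lt_t] := sup_adherent e_gt0 E_sup.
have le_ts : t <= s by apply: sup_upper_bound.
case: (tE) => _ t_stable.
have := right_stable_horner_lt0 (F_monic t) t_stable z_lt0.
have st_ge0 : 0 <= (s - t)%:C by rewrite ler0c subr_ge0.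
rewrite sizeF (FE t s) (rootP z_root) add0r normrM rmorphB distrC -rmorphB.
rewrite (ger0_norm st_ge0); apply/negP.
rewrite -real_ltNge ?(gtr0_real c_gt0) ?ger0_real ?mulr_ge0 //.
apply: (@le_lt_trans _ _ ((s - t)%:C * (`|r.[z]| + 1))).
  by rewrite ler_wpM2l // lerDl.
by rewrite -ltr_pdivlMr // -/c -e_real ltcR ltrBlDl -ltrBlDr.
Qed.

(** * Eigenvalues in the right half-plane *)

Lemma P_matrix_det (R : numDomainType) (n : nat) (A : 'M[R]_n) :
  P_matrix A -> 0 < \det A.
Proof.
move=> A_P; case: (posnP n) => [n0|n_gt0].
  by move: A A_P; rewrite n0 => A _; rewrite det_mx00.
have <- : principal_minor A setT = \det A.
  rewrite -[A in RHS](_ : mxsub id id A = A); last by apply/matrixP => i j; rewrite mxE.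
  apply: det_mxsub_codom; [exact: enum_val_inj | exact: inj_id |].
  move=> i; rewrite (codom_f id); apply/codomP.
  by exists (enum_rank_in (in_setT i) i); rewrite enum_rankK_in ?inE.
by apply: A_P; apply/set0Pn; exists (Ordinal n_gt0).
Qed.

Lemma P_matrix_drsubmx (R : numDomainType) (m n : nat) (A : 'M[R]_(m + n)) :
  P_matrix A -> P_matrix (drsubmx A).
Proof.
move=> A_P S S_neq0.
have -> : principal_minor (drsubmx A) S =
    principal_minor A [set rshift m i | i in S].
  rewrite /principal_minor.
  pose f i := rshift m (@enum_val _ (mem S) i).
  have -> : mxsub (@enum_val _ (mem S)) (@enum_val _ (mem S)) (drsubmx A) = mxsub f f A.
    by apply/matrixP => i j; rewrite !mxE.
  apply: det_mxsub_codom.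
  - by move=> i j /rshift_inj /enum_val_inj.
  - exact: enum_val_inj.
  move=> i; apply/codomP/codomP => -[j ->].
    have jS : f j \in [set rshift m i | i in S] by apply: imset_f; exact: enum_valP.
    by exists (enum_rank_in jS (f j)); rewrite enum_rankK_in.
  have /imsetP[k kS ->] := enum_valP j.
  by exists (enum_rank_in kS k); rewrite /f enum_rankK_in.
apply: A_P; have /set0Pn[i iS] := S_neq0.
by apply/set0Pn; exists (rshift m i); apply: imset_f.
Qed.

(** The induction hypothesis on the matrix. The inequality is weak so as to survive limits in [d],
    and its positive left side still excludes zeros of the determinant. *)
Definition scaled_sqr_bound (R : numDomainType) (n : nat) (A : 'M[R]_n) : Prop :=
  forall (d : 'rV[R]_n) (x : R), (forall i, 0 < d 0 i) -> 0 < x ->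
    x ^+ n <= \det (x%:M + (diag_mx d *m A) *m (diag_mx d *m A)).

Lemma poly_ge_at0 (R : rcfType) (p : {poly R}) (c : R) :
  (forall t, 0 < t -> c <= p.[t]) -> c <= p.[0].
Proof.
move=> p_ge; rewrite leNgt; apply/negP => lt_p0.
have /(poly_cont 0 p)[d d_gt0 dP] : 0 < c - p.[0] by rewrite subr_gt0.
have := dP (d / 2); rewrite subr0 gtr0_norm ?divr_gt0 // ltr_pdivrMr // ltr_pMr // ltr1n.
move=> /(_ isT) /ltr_normlW; rewrite ltrD2r ltNge.
by rewrite p_ge // divr_gt0.
Qed.

(** The determinant is a polynomial in the first diagonal entry t. At t = 0 the first row of DA
    vanishes, the matrix becomes block lower triangular with corner x, and one factor x > 0
    cancels. *)
Lemma scaled_sqr_bound_drsubmx (R : rcfType) (n : nat) (A : 'M[R]_(1 + n)) :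
  scaled_sqr_bound A -> scaled_sqr_bound (drsubmx A).
Proof.
move=> A_bound d x d_gt0 x_gt0.
(* Abstracting over the ring gives one formula for both the polynomial matrix ([polyC], ['X]) and
   its values ([id], [t]). *)
pose D (S : comNzRingType) (f : R -> S) (t : S) : 'M[S]_(1 + n) :=
  diag_mx (row_mx (const_mx t) (map_mx f d)).
pose M (S : comNzRingType) (f : R -> S) (t : S) :=
  (f x)%:M + (D S f t *m map_mx f A) *m (D S f t *m map_mx f A).
pose p := \det (M {poly R} polyC 'X).
have pE t : p.[t] = \det (M R id t).
  rewrite -[LHS]/(horner_eval t _) -det_map_mx; congr (\det _).
  rewrite /M map_mxD !map_mxM /= map_scalar_mx map_diag_mx map_row_mx map_const_mx.
  rewrite /= /horner_eval hornerC hornerX -!map_mx_comp.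
  have idE m k (B : 'M[R]_(m, k)) :
      map_mx (horner^~ t \o polyC) B = map_mx id B.
    by apply/matrixP => i j; rewrite !mxE /= hornerC.
  by rewrite !idE.
have p_ge t : 0 < t -> x ^+ n.+1 <= p.[t].
  move=> t_gt0; rewrite pE /M /D !map_mx_id //.
  apply: A_bound => // i; rewrite mxE; case: splitP => j _ //.
  by rewrite mxE.
have := poly_ge_at0 p_ge; rewrite pE /M /D !map_mx_id //.
rewrite -{1 2}(submxK A) diag_mx_row !mulmx_block scalar_mx_block add_block_mx.
have -> : diag_mx (const_mx 0) = 0 :> 'M[R]_1.
  by apply/matrixP => i j; rewrite !mxE mul0rn.
rewrite !(mul0mx, add0r, addr0, mulmx0) det_lblock det_scalar expr1 exprS.
by rewrite ler_pM2l.
Qed.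

Definition row0_scale (R : pzSemiRingType) (n : nat) (t : R) : 'rV[R]_(1 + n) :=
  \row_j (if j == 0 then t else 1).

(** Only row 0 depends on [t], and it does so affinely; the right-hand side interpolates between the
    values at t = 0 and t = 1. *)
Lemma char_poly_row0_scale (R : comNzRingType) (n : nat) (A : 'M[R]_(1 + n)) (t : R) :
  char_poly (diag_mx (row0_scale n t) *m A) =
  'X * char_poly (drsubmx A) + t *: (char_poly A - 'X * char_poly (drsubmx A)).
Proof.
have -> : 'X * char_poly (drsubmx A) = char_poly (diag_mx (row0_scale n 0) *m A).
  have -> : row0_scale n 0 = row_mx (const_mx 0 : 'rV[R]_1) (const_mx 1).
    by apply/rowP => j; rewrite !mxE; case: split_ordP => k ->; rewrite mxE ?ord1.
  rewrite diag_mx_row diag_const_mx diag_const_mx raddf0 -[A in RHS]submxK mulmx_block.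
  rewrite !mul0mx !mul1mx !add0r.
  rewrite /char_poly /char_poly_mx scalar_mx_block map_block_mx opp_block_mx add_block_mx.
  by rewrite !map_mx0 !oppr0 !addr0 det_lblock det_scalar1.
rewrite scalerBr addrCA -{1}[char_poly (diag_mx (row0_scale n 0) *m A)]scale1r -scalerBl.
rewrite -!mul_polyC; apply: (determinant_multilinear (i0 := 0)).
- apply/rowP => j; rewrite !mul_diag_mx !mxE /= polyCB !polyCM.
  by rewrite polyC0; ring.
- by apply/matrixP => i j; rewrite !mul_diag_mx !mxE /= mul1r.
- by apply/matrixP => i j; rewrite !mul_diag_mx !mxE /= mul1r.
Qed.

Lemma ltr_normB_pos (C : numClosedFieldType) (z a : C) :
  'Re z <= 0 -> 0 < a -> `|z| < `|z - a|.
Proof.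
move=> z_le0 a_gt0; have a_real := gtr0_real a_gt0.
rewrite -(ltr_pXn2r (n := 2)) ?nnegrE // !normC2_Re_Im !raddfB /=.
rewrite (Creal_ReP _ a_real) (Creal_ImP _ a_real) subr0 ltrD2r sqrrB.
rewrite -addrA ltrDl ltr_wpDl ?exprn_gt0 // -mulrnAl -mulNr.
by rewrite mulr_ge0 ?oppr_ge0 ?(ltW a_gt0) // mulrn_wle0.
Qed.

Lemma right_stable_mulX (C : numClosedFieldType) (q h : {poly C}) (m : C) :
  q \is monic -> right_stable q -> (size h <= size q)%N -> 0 < m ->
  exists2 k : C, 0 < k & forall t, 0 < t <= k ->
    right_stable ('X * q + t *: ('X * h - m *: q)).
Proof.
move=> q_monic q_stable size_h m_gt0.
have [k k_gt0 kP] := right_stable_dominates q_monic q_stable size_h.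
exists k => // t /andP[t_gt0 le_tk] z /rootP z_root.
(* A root z satisfies (z - tm) q(z) = - t z h(z); when Re z <= 0 this gives
   |z - tm| <= |z|, although z is closer to 0 than to tm > 0. *)
rewrite real_ltNge ?real0 ?Creal_Re //; apply/negP => z_le0.
have q_neq0 : 0 < `|q.[z]|.
  rewrite normr_gt0; apply/negP => /q_stable.
  by move/lt_geF; rewrite z_le0.
have eq_z : (z - t * m) * q.[z] = - (t * (z * h.[z])).
  by rewrite !hornerE in z_root; apply/subr0_eq; rewrite -[RHS]z_root; ring.
have lt_z := ltr_normB_pos z_le0 (mulr_gt0 t_gt0 m_gt0).
have : `|z - t * m| * `|q.[z]| <= `|z| * `|q.[z]|.
  rewrite -normrM eq_z normrN !normrM mulrCA ler_wpM2l //.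
  apply: le_trans (kP z z_le0); rewrite ler_wpM2r // gtr0_norm //.
by rewrite ler_pM2r // => /(lt_le_trans lt_z); rewrite ltxx.
Qed.

(** If z = iy, then - z^2 = y^2 is a zero of det(x + A^2): the bound excludes y != 0, and det A > 0
    excludes y = 0. *)
Lemma scaled_sqr_bound_Re_neq0 (R : rcfType) (n : nat) (A : 'M[R]_n) (z : R[i]) :
  0 < \det A ->
  (forall x, 0 < x -> x ^+ n <= \det (x%:M + A *m A)) ->
  root (map_poly (real_complex R) (char_poly A)) z -> 'Re z != 0.
Proof.
move=> detA_gt0 A_bound; rewrite map_char_poly => z_root; apply/negP => /eqP.
rewrite -complexRe => -[Rez].
have z2 : - z ^+ 2 = (complex.Im z ^+ 2)%:C.
  by case: z Rez {z_root} => a b /= ->; rewrite expr2; simpc.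
have := det_sqr_root z_root; rewrite z2 -map_mxM -map_scalar_mx -map_mxD det_map_mx.
move/eqP; rewrite fmorph_eq0 => /eqP det0.
have [Imz|Imz] := eqVneq (complex.Im z) 0.
  move: det0; rewrite Imz expr0n /=.
  rewrite raddf0 add0r det_mulmx => /eqP.
  by rewrite mulf_eq0 orbb gt_eqF.
have Im2_gt0 : 0 < complex.Im z ^+ 2 by rewrite exprn_even_gt0.
by have := A_bound _ Im2_gt0; rewrite det0 leNgt exprn_gt0.
Qed.

Lemma scaled_sqr_bound_stable (R : realType) (n : nat) (A : 'M[R]_n) :
  P_matrix A -> scaled_sqr_bound A ->
  right_stable (map_poly (real_complex R) (char_poly A)).
Proof.
elim: n A => [|n IHn] A A_P A_bound.
  by move=> z; rewrite /char_poly det_mx00 rmorph1 (negPf (root1 _)).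
pose N : 'M_n := drsubmx (A : 'M_(1 + n)).
have N_P : P_matrix N by exact: P_matrix_drsubmx.
have N_bound : scaled_sqr_bound N by exact: scaled_sqr_bound_drsubmx.
have {IHn} N_stable := IHn N N_P N_bound.
have detA_gt0 := P_matrix_det A_P; have detN_gt0 := P_matrix_det N_P.
pose toC := map_poly (real_complex R).
(* This [m] makes [r + m *: q] vanish at 0, since the constant terms of [char_poly A] and [q] are
   det A and det N with opposite signs. To first order in t, the root 0 of ['X * q] moves to t m >
   0. *)
pose q := char_poly N; pose r := char_poly A - 'X * q; pose m := \det A / \det N.
have m_gt0 : 0 < m by exact: divr_gt0.
have q_monic : q \is monic by exact: char_poly_monic.
have q_neq0 : q != 0 by exact: monic_neq0.
have size_q : size q = n.+1 by exact: size_char_poly.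
have Xq_monic : 'X * q \is monic by rewrite monicMl ?monicX.
have size_Xq : size ('X * q) = n.+2 by rewrite mulrC size_mulX // size_q.
have size_r : (size r < size ('X * q)%R)%N.
  rewrite size_Xq ltnS; apply/leq_sizeP => j; rewrite leq_eqVlt => /predU1P[<-|lt_nj].
    have /monicP := char_poly_monic A; rewrite lead_coefE size_char_poly /= coefB => ->.
    by have /monicP := Xq_monic; rewrite lead_coefE size_Xq /= => ->; rewrite subrr.
  by rewrite coefB !nth_default ?subrr // ?size_Xq ?size_char_poly.
have [h def_r size_h] : exists2 h, r = 'X * h - m *: q & (size h <= size q)%N.
  have /factor_theorem[h def_h] : root (r + m *: q) 0.
    rewrite /root /r !hornerE !horner_char_poly !raddf0 !add0r addr0.
    rewrite -!scaleN1r !detZ exprS /m; apply/eqP.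
    by field; rewrite gt_eqF.
  rewrite subr0 in def_h.
  exists h; first by rewrite mulrC -def_h addrK.
  have [->|h_neq0] := eqVneq h 0; first by rewrite size_poly0.
  rewrite -ltnS -(size_mulX h_neq0) -def_h size_q.
  apply: leq_trans (size_polyD _ _) _; rewrite geq_max -size_Xq ltnW //=.
  by rewrite (leq_trans (size_scale_leq _ _)) // size_q size_Xq.
have p_def t : toC (char_poly (diag_mx (row0_scale n t) *m A)) =
    toC ('X * q) + t%:C *: toC r.
  by rewrite char_poly_row0_scale /toC rmorphD /= map_polyZ.
have [k k_gt0 kP] : exists2 k : R[i], 0 < k & forall t, 0 < t <= k ->
    right_stable (toC ('X * q) + t *: toC r).
  have := @right_stable_mulX _ (toC q) (toC h) m%:C.
  rewrite /toC map_monic !size_map_poly ltcR => /(_ q_monic N_stable size_h m_gt0).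
  have -> : map_poly (real_complex R) r = 'X * toC h - m%:C *: toC q.
    by rewrite def_r /toC rmorphB /= map_polyZ (rmorphM _ 'X) /= map_polyX.
  by rewrite (rmorphM _ 'X) /= map_polyX.
have k_real : (complex.Re k)%:C = k by rewrite complexRe; apply/Creal_ReP/gtr0_real.
move: (complex.Re k) k_real k_gt0 kP => {}k <-; rewrite ltcR => k_gt0 kP.
(* The homotopy cannot start at t = 0, where ['X * q] has the root 0 on the imaginary axis; it
   starts at a small positive [a]. *)
pose a := Num.min k 1.
have a_gt0 : 0 < a by rewrite lt_min k_gt0 ltr01.
have a_le1 : a <= 1 by rewrite ge_min lexx orbT.
have -> : char_poly A = char_poly (diag_mx (row0_scale n 1) *m A).
  rewrite (_ : row0_scale n 1 = const_mx 1) ?diag_const_mx ?mul1mx //.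
  by apply/rowP => j; rewrite !mxE; case: eqP.
rewrite -/toC p_def; apply: right_stable_homotopy a_le1 _ _ _ _.
- by rewrite map_monic.
- by rewrite !size_map_poly.
- move=> t /andP[le_at _] z; rewrite -p_def.
  have t_gt0 : 0 < t by exact: lt_le_trans le_at.
  apply: scaled_sqr_bound_Re_neq0 => [|x x_gt0].
    rewrite det_mulmx det_diag mulr_gt0 // prodr_gt0 // => i _.
    by rewrite mxE; case: ifP.
  by apply: A_bound => // i; rewrite mxE; case: ifP.
- by apply: kP; rewrite ltcR lecR a_gt0 ge_min lexx.
Qed.

(** * The sector bound *)

Lemma polar_exp (R : realType) (r t : R) (k : nat) :
  ((r * cos t) +i* (r * sin t)) ^+ k =
  (r ^+ k * cos (k%:R * t)) +i* (r ^+ k * sin (k%:R * t)).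
Proof.
elim: k => [|k IHk]; first by rewrite !expr0 mul0r cos0 sin0 !mul1r.
rewrite exprS IHk -natr1 mulrDl mul1r cosD sinD; simpc.
by congr (_ +i* _); rewrite exprS; ring.
Qed.

Lemma Im_horner_polar (R : realType) (p : {poly R}) (r t : R) :
  complex.Im (map_poly (real_complex R) p).[(r * cos t) +i* (r * sin t)] =
  \sum_(i < size p) p`_i * (r ^+ i * sin (i%:R * t)).
Proof.
rewrite horner_coef size_map_poly raddf_sum /=; apply: eq_bigr => i _.
by rewrite coef_map polar_exp /=; simpc.
Qed.

(** For 0 < i <= n the angle i t stays in the interval from 0 to pi, so no term is negative, and the
    term i = 1 is strictly positive. The sum is the imaginary part of p at the point of modulus r
    and argument t. *)
Lemma sum_coef_sin_gt0 (R : realType) (n : nat) (p : {poly R}) (r t : R) :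
  (0 < n)%N -> size p = n.+1 -> (forall i, (i <= n)%N -> 0 < p`_i) ->
  0 < r -> 0 < t -> n%:R * t < pi ->
  0 < \sum_(i < size p) p`_i * (r ^+ i * sin (i%:R * t)).
Proof.
move=> n_gt0 size_p p_gt0 r_gt0 t_gt0 lt_nt.
have sin_gt0 i : (0 < i <= n)%N -> 0 < sin (i%:R * t).
  move=> /andP[i_gt0 le_in]; rewrite sin_gt0_pi // mulr_gt0 ?ltr0n //=.
  by apply: le_lt_trans lt_nt; rewrite ler_pM2r // ler_nat.
rewrite size_p (bigD1 (inord 1)) //= inordK // ltr_wpDr //.
  apply: sumr_ge0 => i _; have := ltn_ord i; rewrite ltnS => le_in.
  rewrite mulr_ge0 ?mulr_ge0 ?exprn_ge0 ?(ltW r_gt0) ?(ltW (p_gt0 _ _)) //.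
  by case: (posnP i) => [->|i_gt0]; rewrite ?mul0r ?sin0 // ltW // sin_gt0 ?i_gt0.
by rewrite !mulr_gt0 ?p_gt0 ?exprn_gt0 ?sin_gt0.
Qed.

Lemma Q_matrix_sqr_sector (R : realType) (n : nat) (A : 'M[R]_n) (z : R[i]) :
  (0 < n)%N -> Q_matrix (A *m A) ->
  root (map_poly (real_complex R) (char_poly A)) z -> 0 < 'Re z ->
  (sin (pi / (2 * n%:R)))%:C * `|z| <= 'Re z.
Proof.
move=> n_gt0 A2_Q; rewrite map_char_poly => z_root.
have w_root : (map_poly (real_complex R) (char_poly (- (A *m A)))).[- z ^+ 2] = 0.
  rewrite map_char_poly horner_char_poly map_mxN map_mxM opprK.
  exact: det_sqr_root.
rewrite -complexRe ltcR normc_def -rmorphM lecR.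
case: z z_root w_root => a b _ w_root /= a_gt0.
set r := Num.sqrt _.
have r2 : r ^+ 2 = a ^+ 2 + b ^+ 2 by rewrite sqr_sqrtr ?addr_ge0 ?sqr_ge0.
have r2_gt0 : 0 < r ^+ 2 by rewrite r2 ltr_wpDr ?sqr_ge0 ?exprn_gt0.
have r_gt0 : 0 < r by rewrite lt_neqAle sqrtr_ge0 andbT eq_sym -sqrf_eq0 gt_eqF.
have n0 : 0 < n%:R :> R by rewrite ltr0n.
rewrite -ler_pdivlMr // leNgt; apply/negP => lt_a.
have [a_ge0 r_ge0] := (ltW a_gt0, ltW r_gt0).
have le_ar : a <= r by rewrite -(ler_pXn2r (n := 2)) ?nnegrE // r2 lerDl sqr_ge0.
have c_itv : -1 <= a / r <= 1.
  rewrite ler_pdivrMr // mul1r le_ar andbT.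
  by rewrite (le_trans _ (divr_ge0 a_ge0 r_ge0)) ?lerN10.
(* [phi] is the absolute value of arg z. If the sector bound fails, [phi] exceeds pi/2 - pi/(2n), so
   t = pi - 2 phi, the absolute argument of - z^2, is below pi/n. *)
set phi := acos (a / r).
have cos_phi : cos phi = a / r by rewrite acosK // in_itv.
have sin_phi : sin phi = `|b| / r.
  have br_ge0 : 0 <= `|b| / r by rewrite divr_ge0 // ltW.
  rewrite sin_acos // -[RHS](ger0_norm br_ge0) -(sqrtr_sqr (`|b| / r)); congr Num.sqrt.
  rewrite !exprMn exprVn real_normK ?num_real // r2; field.
  by rewrite -r2 gt_eqF.
have phi_ge0 : 0 <= phi by exact: acos_ge0.
have phi_le : phi <= pi by exact: acos_lepi.
have pi_gt0 := pi_gt0 R.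
have pi_n : pi / (2 * n%:R) = pi / n%:R / 2 :> R by field; rewrite gt_eqF.
have pin_gt0 : 0 < pi / n%:R :> R by rewrite divr_gt0.
have pin_le : pi / n%:R <= pi :> R by rewrite ler_pdivrMr // ler_peMr ?ler1n // ltW.
have phi_gt : pi / 2 - pi / (2 * n%:R) < phi.
  rewrite -(@ltr_cos R) ?in_itv /= ?phi_ge0 //; last by rewrite pi_n; lra.
  by rewrite cos_phi cosB cos_pihalf sin_pihalf mul0r add0r mul1r.
have phi_lt : phi < pi / 2.
  rewrite -(@ltr_cos R) ?in_itv /= ?phi_ge0 ?cos_pihalf ?cos_phi ?divr_gt0 //; lra.
pose t : R := pi - phi *+ 2.
have t_gt0 : 0 < t by rewrite /t; lra.
have lt_nt : n%:R * t < pi by rewrite mulrC -ltr_pdivlMr // /t; lra.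
have cos_t : r ^+ 2 * cos t = b ^+ 2 - a ^+ 2.
  rewrite /t cosB cospi sinpi cos_mulr2n cos_phi.
  by rewrite mul0r addr0 exprMn exprVn r2; field; rewrite -r2 gt_eqF.
have sin_t : r ^+ 2 * sin t = (a * `|b|) *+ 2.
  rewrite /t sinB cospi sinpi sin_mulr2n cos_phi sin_phi.
  by field; rewrite gt_eqF.
have := sum_coef_sin_gt0 n_gt0 (size_char_poly _)
  (fun i => Q_matrix_coef_gt0 A2_Q (i := i)) r2_gt0 t_gt0 lt_nt.
(* The argument of - z^2 is - t for b >= 0 and t for b < 0; replacing t by - t only negates the sum
   of sines. *)
have [b_ge0|b_lt0] := lerP 0 b.
  have w_def : - (a +i* b) ^+ 2 = (r ^+ 2 * cos (- t)) +i* (r ^+ 2 * sin (- t)).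
    rewrite cosN sinN mulrN cos_t sin_t ger0_norm // expr2; simpc.
    by congr (_ +i* _); ring.
  have := Im_horner_polar (char_poly (- (A *m A))) (r ^+ 2) (- t).
  rewrite -w_def w_root /=.
  under eq_bigr do rewrite mulrN sinN !mulrN.
  by rewrite sumrN => /esym /eqP; rewrite oppr_eq0 => /eqP ->; rewrite ltxx.
have w_def : - (a +i* b) ^+ 2 = (r ^+ 2 * cos t) +i* (r ^+ 2 * sin t).
  rewrite cos_t sin_t ltr0_norm // expr2; simpc.
  by congr (_ +i* _); ring.
have := Im_horner_polar (char_poly (- (A *m A))) (r ^+ 2) t.
by rewrite -w_def w_root /= => <-; rewrite ltxx.
Qed.

(** * Diagonal normalisation and the determinant bound *)

Lemma P_matrix_diag_gt0 (R : numDomainType) (n : nat) (A : 'M[R]_n) (i : 'I_n) :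
  P_matrix A -> 0 < A i i.
Proof.
move=> A_P; suff <- : principal_minor A [set i] = A i i.
  by apply: A_P; apply/set0Pn; exists i; rewrite inE.
transitivity (\det (mxsub (fun _ : 'I_1 => i) (fun _ : 'I_1 => i) A)); last first.
  by rewrite det_mx11 mxE.
apply: det_mxsub_codom; [exact: enum_val_inj | by move=> j k _; rewrite !ord1 |].
move=> j; apply/codomP/codomP => -[k ->].
  by exists 0; have /set1P := enum_valP k.
have ii : i \in [set i] by rewrite inE.
by exists (enum_rank_in ii i); rewrite enum_rankK_in.
Qed.

Lemma P_matrix_diag_mulmx (R : numDomainType) (n : nat) (d : 'rV[R]_n) (A : 'M[R]_n) :
  (forall i, 0 < d 0 i) -> P_matrix A -> P_matrix (diag_mx d *m A).
Proof.
move=> d_gt0 A_P S S_neq0; rewrite /principal_minor.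
set f := @enum_val _ (mem S).
have -> : mxsub f f (diag_mx d *m A) = diag_mx (\row_i d 0 (f i)) *m mxsub f f A.
  by rewrite !mul_diag_mx; apply/matrixP => i j; rewrite !mxE.
rewrite det_mulmx det_diag mulr_gt0 //; last exact: A_P.
by rewrite prodr_gt0 // => i _; rewrite mxE.
Qed.

Lemma positive_diagonal_diag_mx (R : numDomainType) (n : nat) (d : 'rV[R]_n) :
  (forall i, 0 < d 0 i) -> positive_diagonal (diag_mx d).
Proof.
by move=> d_gt0; split=> [|i]; [exact: diag_mx_is_diag | rewrite mxE eqxx mulr1n].
Qed.

Lemma AGM_seq (R : realFieldType) (T : eqType) (s : seq T) (F : T -> R) :
  {in s, forall x, 0 <= F x} ->
  \prod_(x <- s) F x <= ((\sum_(x <- s) F x) / (size s)%:R) ^+ size s.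
Proof.
move=> F_ge0; rewrite !(big_tnth _ _ s).
have := (@leif_AGM _ 'I_(size s) predT (fun i => F (tnth (in_tuple s) i))).
rewrite card_ord => /(_ (fun i _ => F_ge0 _ (mem_tnth i (in_tuple s)))).
by move=> [].
Qed.

(** Multiplying c |z| <= Re z over the eigenvalues bounds the left side by the product of the real
    parts. AM-GM then applies; the real parts sum to the trace because the trace is real. *)
Lemma det_le_sector (R : realType) (n : nat) (A : 'M[R]_n) (c : R) :
  (0 < n)%N -> 0 <= c ->
  (forall z, root (map_poly (real_complex R) (char_poly A)) z ->
    c%:C * `|z| <= 'Re z) ->
  c ^+ n * `|\det A| <= (\tr A / n%:R) ^+ n.
Proof.
move=> n_gt0 c_ge0 A_sector.
have [s def_p] := closed_field_poly_normal (map_poly (real_complex R) (char_poly A)).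
have /monicP p_monic : map_poly (real_complex R) (char_poly A) \is monic.
  by rewrite map_monic char_poly_monic.
rewrite {}p_monic scale1r in def_p.
have size_s : size s = n.
  apply: succn_inj.
  by rewrite -(size_prod_XsubC s id) -def_p size_map_poly size_char_poly.
have s_sector z : z \in s -> c%:C * `|z| <= 'Re z.
  by move=> sz; apply: A_sector; rewrite def_p root_prod_XsubC.
have cC_ge0 : 0 <= c%:C by rewrite ler0c.
have sum_s : \sum_(z <- s) complex.Re z = \tr A.
  have := coefPn_prod_XsubC (ps := s); rewrite size_s -lt0n n_gt0 => /(_ isT).
  rewrite -def_p coef_map char_poly_trace //= => /(congr1 (@complex.Re R)).
  rewrite -[in RHS]sumrN [in RHS]raddf_sum /= => sum_s; apply: oppr_inj.
  by rewrite sum_s -sumrN; apply: eq_bigr => -[].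
have prod_s : `|\prod_(z <- s) z| = `|\det A|%:C.
  have := coef0_prod_XsubC s; rewrite -def_p coef_map char_poly_det size_s /=.
  move/(congr1 Num.norm).
  rewrite normrM normrX normrN1 expr1n mul1r => <-.
  by rewrite normc_def /= expr0n addr0 sqrtr_sqr normrM normrX normrN1 expr1n mul1r.
apply: (@le_trans _ _ (\prod_(z <- s) complex.Re z)); last first.
  rewrite -sum_s -size_s; apply: AGM_seq => z /s_sector.
  rewrite -complexRe => le_z; rewrite -ler0c; apply: le_trans le_z.
  exact: mulr_ge0.
rewrite -lecR !rmorphM rmorphXn rmorph_prod /= -prod_s normr_prod -size_s.
have -> : c%:C ^+ size s = \prod_(z <- s) c%:C.
  by elim: (s) => [|z l IHl]; rewrite ?big_nil // big_cons -IHl exprS.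
rewrite -big_split big_seq [leRHS]big_seq; apply: ler_prod => z /s_sector.
by rewrite /= complexRe mulr_ge0.
Qed.

Theorem theorem16 (R : realType) (n : nat) (n_gt0 : (0 < n)%N) (A : 'M[R]_n)
    (A_P : P_matrix A)
    (DA2_Q : forall D : 'M[R]_n, positive_diagonal D ->
       Q_matrix ((D *m A) *m (D *m A))) :
  \det A <= (sin (pi / (2 * n%:R)) ^+ n)^-1 * \prod_(i < n) A i i.
Proof.
have a_gt0 i : 0 < A i i by exact: P_matrix_diag_gt0.
pose d : 'rV[R]_n := \row_i (A i i)^-1.
have d_gt0 i : 0 < d 0 i by rewrite mxE invr_gt0.
pose B := diag_mx d *m A.
have B_P : P_matrix B by exact: P_matrix_diag_mulmx.
have B2_Q : Q_matrix (B *m B) by apply: DA2_Q; exact: positive_diagonal_diag_mx.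
(* A further scaling of [B] merges with [diag_mx d] into one positive diagonal factor of [A], so the
   hypothesis covers it. *)
have B_bound : scaled_sqr_bound B.
  move=> e x e_gt0 x_gt0; rewrite /B (mulmxA (diag_mx e)) mulmx_diag.
  apply: Q_matrix_det (ltW x_gt0); apply: DA2_Q; apply: positive_diagonal_diag_mx => i.
  by rewrite mxE mulr_gt0.
have B_stable := scaled_sqr_bound_stable B_P B_bound.
set c := sin _.
have c_gt0 : 0 < c.
  have pi_gt0 := pi_gt0 R.
  have n_ge1 : 1 <= n%:R :> R by rewrite ler1n.
  rewrite /c sin_gt0_pi // divr_gt0 ?mulr_gt0 ?ltr0n //=.
  by rewrite ltr_pdivrMr ?mulr_gt0 ?ltr0n // ltr_pMr //; lra.
have := det_le_sector n_gt0 (ltW c_gt0)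
  (fun z z_root => Q_matrix_sqr_sector n_gt0 B2_Q z_root (B_stable z z_root)).
have -> : \tr B = n%:R.
  rewrite /mxtrace (eq_bigr (fun=> 1)) ?sumr_const ?card_ord // => i _.
  by rewrite /B mul_diag_mx !mxE mulVf // gt_eqF.
rewrite divff ?pnatr_eq0 -?lt0n // expr1n gtr0_norm ?P_matrix_det //.
have -> : \det B = \det A / \prod_i A i i.
  rewrite det_mulmx det_diag mulrC -prodfV; congr (_ * _).
  by apply: eq_bigr => i _; rewrite mxE.
rewrite mulrA ler_pdivrMr ?prodr_gt0 // mul1r.
by rewrite -ler_pdivlMl ?exprn_gt0.
Qed.
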